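(* Let $v=v^{\gamma,\delta}$ and $w=v^{\alpha,\beta}$ be Jacobi weights with $\gamma,\delta\ge 0$ and $\alpha,\beta>-1$. Fix constants $c_2\ge c_1>1$ and write $m\approx n$ for pairs $n,m\in\mathbb{N}$ with $c_1m\le n\le c_2m$. Assume that the maps $V_n^m(w):C^0_v\to C^0_v$ are uniformly bounded with respect to $n,m\in\mathbb{N}$ with $m\approx n$, i.e. there is $\mathcal{C}>0$ with $\|V_n^m(w,f)v\|_\infty\le \mathcal{C}\|fv\|_\infty$ for all $f\in C^0_v$ and all $m\approx n$. Then: (i) For every $r\ge 0$, the maps $V_n^m(w):B_r(v)\to B_r(v)$ are uniformly bounded with respect to $m\approx n$, i.e. $\|V_n^m(w,f)\|_{B_r(v)}\le \mathcal{C}\|f\|_{B_r(v)}$ for all $f\in B_r(v)$ with $\mathcal{C}$ independent of $n,m,f$; and $$\lim_{m\approx n\to\infty}\|f-V_n^m(w,f)\|_{B_r(v)}=0,\qquad \forall f\in B_r(v),\ \forall r\ge 0 .$$ (ii) For every $r>0$ and all $f\in B_r(v)$, $$\|f-V_n^m(w,f)\|_{B_0(v)}\le \mathcal{C}\,\frac{\log n}{n^{r}}\,\|f\|_{B_r(v)},$$ and for all $r\ge s>0$ and all $f\in B_r(v)$, $$\|f-V_n^m(w,f)\|_{B_s(v)}\le \frac{\mathcal{C}}{n^{r-s}}\,\|f\|_{B_r(v)},$$ for all $m\approx n$, where in both cases $\mathcal{C}>0$ is independent of $n,m$ and $f$.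
   Context: For real exponents $p,q$ put $v^{p,q}(x):=(1-x)^p(1+x)^q$, $x\in(-1,1)$. Space $C^0_v$ ($v=v^{\gamma,\delta}$, $\gamma,\delta\ge 0$): all functions $f$ continuous on $(-1,1)$ such that $\lim_{x\to 1}f(x)v(x)=0$ if $\gamma>0$ and $\lim_{x\to -1}f(x)v(x)=0$ if $\delta>0$; at an endpoint where the exponent is $0$, $f$ is required to be continuous up to that endpoint. Norm: $\|f\|_{C^0_v}=\|fv\|_\infty=\max_{x\in[-1,1]}|f(x)|v(x)$ (with $fv$ extended continuously to $[-1,1]$). $\mathbb{P}_n$ is the space of algebraic polynomials of degree at most $n$, and $E_n(f)_v:=\inf_{P\in\mathbb{P}_n}\|(f-P)v\|_\infty$. For $r\ge 0$, $B_r(v):=\{f\in C^0_v:\ \sum_{n=1}^\infty (n+1)^{r-1}E_n(f)_v<\infty\}$ with norm $\|f\|_{B_r(v)}:=\|fv\|_\infty+\sum_{n=1}^\infty (n+1)^{r-1}E_n(f)_v$ (so for $r=0$ the sum is $\sum_{n\ge1} E_n(f)_v/(n+1)$). De la Vallée Poussin (VP) operator: for $w=v^{\alpha,\beta}$, $\alpha,\beta>-1$, let $p_j(w,\cdot)$ be the orthonormal Jacobi polynomials with respect to $w$ on $[-1,1]$ (positive leading coefficients), $x_1,\dots,x_n$ the zeros of $p_n(w,\cdot)$, and $\lambda_k:=\big(\sum_{j=0}^{n-1}p_j(w,x_k)^2\big)^{-1}$. For integers $0<m<n$, $$V_n^m(w,f,x)=\sum_{k=1}^n f(x_k)\,\lambda_k\sum_{j=0}^{n+m-1}\mu_{n,j}^m\,p_j(w,x)\,p_j(w,x_k),$$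 where $\mu_{n,j}^m=1$ for $0\le j\le n-m$ and $\mu_{n,j}^m=\frac{n+m-j}{2m}$ for $n-m<j<n+m$. The limit over $m\approx n\to\infty$ means $n\to\infty$ along pairs with $c_1m\le n\le c_2m$. *)

(* Defs.v *)
From mathcomp Require Import all_boot all_order all_algebra.
From mathcomp Require Import all_classical all_reals all_analysis.
Import Order.TTheory GRing.Theory Num.Theory numFieldNormedType.Exports.

Set Implicit Arguments.
Unset Strict Implicit.
Unset Printing Implicit Defensive.

Local Open Scope classical_set_scope.
Local Open Scope ring_scope.

(* Since [0 `^ 0 = 1] and [0 `^ p = 0] for [p != 0], for nonnegative exponents
   this is also the continuous extension of the weight to the endpoints. *)
Definition jweight (R : realType) (p q x : R) : R :=
  (1 - x) `^ p * (1 + x) `^ q.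

(* Functions on the interval are represented by [f : R -> R]. At an endpoint
   with exponent 0, the value of [f] is its limit; at an endpoint with positive
   exponent, the value of [f] is irrelevant. *)
Definition C0v (R : realType) (gamma delta : R) (f : R -> R) : Prop :=
  [/\ {in `]-1, 1[, continuous f},
      if 0 < gamma then f x * jweight gamma delta x @[x --> 1^'-] --> (0 : R)
      else f x @[x --> 1^'-] --> f 1
    & if 0 < delta then f x * jweight gamma delta x @[x --> (-1)^'+] --> (0 : R)
      else f x @[x --> (-1)^'+] --> f (-1)].

Definition wnorm (R : realType) (gamma delta : R) (f : R -> R) : \bar R :=
  ereal_sup [set (`|f x| * jweight gamma delta x)%:E | x in `[-1, 1]].

Definition best_approx (R : realType) (gamma delta : R) (n : nat)
    (f : R -> R) : \bar R :=
  ereal_inf [set wnorm gamma delta (f \- horner P)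
            | P in [set P : {poly R} | (size P <= n.+1)%N]].

Definition besov_sum (R : realType) (gamma delta r : R) (f : R -> R) : \bar R :=
  (\sum_(1 <= n <oo)
     ((n.+1)%:R `^ (r - 1))%:E * best_approx gamma delta n f)%E.

Definition besov (R : realType) (gamma delta r : R) (f : R -> R) : Prop :=
  C0v gamma delta f /\ (besov_sum gamma delta r f < +oo)%E.

Definition besov_norm (R : realType) (gamma delta r : R) (f : R -> R) : \bar R :=
  (wnorm gamma delta f + besov_sum gamma delta r f)%E.

(* These conditions determine the family [p] uniquely. *)
Definition orthonormal_jacobi (R : realType) (alpha beta : R)
    (p : nat -> {poly R}) : Prop :=
  [/\ forall j, size (p j) = j.+1,
      forall j, 0 < lead_coef (p j)
    & forall i j : nat,
        (\int[lebesgue_measure]_(x in `](-1)%R, 1%R[)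
           ((p i).[x] * (p j).[x] * jweight alpha beta x)%:E)%E
        = ((i == j)%:R)%:E].

Definition christoffel (R : realType) (p : nat -> {poly R}) (n : nat)
    (x : R) : R :=
  (\sum_(j < n) (p j).[x] ^+ 2)^-1.

Definition vp_coef (R : realType) (n m j : nat) : R :=
  if (j <= n - m)%N then 1 else ((n + m)%:R - j%:R) / (2 * m)%:R.

(* The outer sum runs over the (finite) set of real zeros of [p n]. *)
Definition vp_op (R : realType) (p : nat -> {poly R}) (n m : nat)
    (f : R -> R) (x : R) : R :=
  \sum_(t \in [set t : R | root (p n) t])
    (f t * christoffel p n t *
     \sum_(j < n + m) vp_coef R n m j * (p j).[x] * (p j).[t]).

Definition comparable_pair (R : realType) (c1 c2 : R) (n m : nat) : Prop :=
  [/\ (0 < m)%N, c1 * m%:R <= n%:R & n%:R <= c2 * m%:R].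

Definition comparable_infty (R : realType) (c1 c2 : R) : set_system (nat * nat) :=
  within [set nm | comparable_pair c1 c2 nm.1 nm.2] (filter_prod \oo \oo).

(* Main.v *)
Require Import Defs.
From HB Require Import structures.
From mathcomp Require Import all_boot all_order all_algebra.
From mathcomp Require Import complex ring lra.
From mathcomp Require Import all_classical all_reals all_analysis measurable_realfun.
Import Order.TTheory GRing.Theory Num.Theory numFieldNormedType.Exports.

Set Implicit Arguments.
Unset Strict Implicit.
Unset Printing Implicit Defensive.

Local Open Scope classical_set_scope.
Local Open Scope ring_scope.

(** By Gauss quadrature [V_n^m] reproduces polynomials of degree at most
    [q = n - m], so the uniform bound gives
    [||(f - V f) v|| <= (1 + C) E_q(f)], where [q] is comparable to [n].
    As [V f] has degree less than [M = n + m], [E_k (f - V f)] is at most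
    [(1 + C) E_q(f)] for [k < M] and at most [E_k(f)] for [k >= M]; hence, with
    [S_s(M)] the sum of [(k + 1)^(s - 1)] over [1 <= k < M],
      [||f - V f||_{B_s} <= (1 + C) (1 + S_s(M)) E_q(f)
                            + sum_{k >= M} (k + 1)^(s - 1) E_k(f)].
    Since [E_k(f)] is nonincreasing in [k], [(1 + S_r(q + 1)) E_q(f)] is at most
    [||f||_{B_r}] and tends to [0], and [S_r] is doubling; everything else is the
    growth of [S_s]: [M^s] for [s > 0] and [log M] for [s = 0]. *)

(** * Gauss quadrature *)

(** Over the algebraically closed extension F[i], [h] has a root a + ib, with b nonzero because [h]
    has no root in [F]. The remainder of [h] modulo [(X - a)^2 + b^2] has degree at most 1 and
    vanishes at a + ib; its imaginary and then its real part force both coefficients to be zero. *)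
Lemma rootless_quadratic_factor (F : rcfType) (h : {poly F}) :
  size h != 1%N -> (forall x, ~~ root h x) ->
  exists a b : F, ('X - a%:P) ^+ 2 + (b ^+ 2)%:P %| h.
Proof.
move=> sh nr.
have /closed_rootP [z] : size (map_poly (real_complex F) h) != 1%N.
  by rewrite size_map_poly.
case: z => a b hz.
have b0 : b != 0.
  apply: contraNneq (nr a) => b0; rewrite b0 in hz.
  by move: hz; rewrite -[(a +i* 0)%C]/((real_complex F) a) fmorph_root.
exists a, b; set Q := (_ + _).
have sQ : size Q = 3%N.
  by rewrite size_polyDl ?size_exp_XsubC // size_polyC; case: eqP.
have Qz : (map_poly (real_complex F) Q).[(a +i* b)%C] = 0.
  rewrite /Q rmorphD rmorphXn rmorphB /= map_polyX !map_polyC /= !hornerE.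
  rewrite /= expr2; simpc; apply/eqP; rewrite eq_complex /=.
  by apply/andP; split; apply/eqP; ring.
have sr : (size (h %% Q)%R <= 2)%N by rewrite -ltnS -sQ ltn_modp -size_poly_eq0 sQ.
have: (map_poly (real_complex F) (h %% Q)).[(a +i* b)%C] = 0.
  move: hz; rewrite /root {1}(divp_eq h Q) rmorphD rmorphM /= hornerD hornerM Qz.
  by rewrite mulr0 add0r => /eqP.
have -> : h %% Q = ((h %% Q)`_0)%:P + (h %% Q)`_1 *: 'X.
  apply/polyP => -[|[|i]]; rewrite !coefE ?mulr0 ?mulr1 ?addr0 ?add0r //.
  by rewrite nth_default //; apply: leq_trans sr _.
rewrite rmorphD /= map_polyC /= map_polyZ map_polyX /= !hornerE.
case; simpc => e1 e2; rewrite /dvdp.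
have c1 : (h %% Q)`_1 = 0.
  by apply/eqP; move/eqP: e2; rewrite mulf_eq0 (negPf b0) orbF.
suff -> : h %% Q = 0 by [].
move: e1; rewrite c1 mul0r addr0 => c0.
apply/polyP => -[|[|i]]; rewrite ?coef0 // nth_default //; exact: leq_trans sr _.
Qed.

Lemma prod_real_roots (F : rcfType) (h : {poly F}) : h != 0 ->
  exists rs : seq F, exists2 g : {poly F},
    h = \prod_(r <- rs) ('X - r%:P) * g & forall x, ~~ root g x.
Proof.
have [k] := ubnP (size h); elim: k h => // k IH h sh h0.
have [[x hx]|nr] := EM (exists x, root h x).
  have [q hq] := factor_theorem _ _ hx.
  have q0 : q != 0 by apply: contraNneq h0 => q0; rewrite hq q0 mul0r.
  have [|rs [g qE gr]] := IH q _ q0.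
    by move: sh; rewrite hq size_mul ?polyXsubC_eq0 // size_XsubC addn2.
  exists (x :: rs); exists g => //.
  by rewrite big_cons hq qE mulrC mulrA.
exists [::]; exists h; first by rewrite big_nil mul1r.
by move=> x; apply/negP => hx; apply: nr; exists x.
Qed.

Section Gauss.
Variables (F : rcfType) (L : {scalar {poly F}}) (p : nat -> {poly F}).
Hypothesis size_p : forall j, size (p j) = j.+1.
Hypothesis orth_p : forall i j, L (p i * p j) = (i == j)%:R.

Lemma ortho_span n (P : {poly F}) : (size P <= n)%N ->
  exists c : nat -> F, P = \sum_(j < n) c j *: p j.
Proof.
elim: n P => [|n IH] P sP.
  by exists (fun=> 0); rewrite big_ord0; apply/eqP; rewrite -size_poly_eq0 -leqn0.
have ln0 : (p n)`_n != 0.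
  by have := lead_coef_eq0 (p n); rewrite /lead_coef size_p -size_poly_eq0 size_p => ->.
pose a := P`_n / (p n)`_n.
have [|c cE] := IH (P - a *: p n).
  apply/leq_sizeP => j; rewrite leq_eqVlt => /orP[/eqP<-|nj].
    by rewrite coefB coefZ divfK // subrr.
  rewrite coefB coefZ !nth_default ?mulr0 ?subrr ?size_p //.
  exact: leq_trans sP nj.
exists (fun j => if (j < n)%N then c j else a).
rewrite big_ord_recr /= ltnn -[LHS](subrK (a *: p n)) cE; congr (_ + _).
by apply: eq_bigr => j _; rewrite ltn_ord.
Qed.

Lemma ortho_expansion n (P : {poly F}) : (size P <= n)%N ->
  P = \sum_(j < n) L (P * p j) *: p j.
Proof.
move=> /ortho_span[c PE]; rewrite {1}PE; apply: eq_bigr => j _; congr (_ *: _).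
rewrite PE mulr_suml linear_sum /= (bigD1 j) //= big1 => [|i ij].
  by rewrite -scalerAl linearZ /= orth_p eqxx addr0 mulr1.
by rewrite -scalerAl linearZ /= orth_p val_eqE (negPf ij) mulr0.
Qed.

Lemma ortho_low n (P : {poly F}) : (size P <= n)%N -> L (P * p n) = 0.
Proof.
move=> /ortho_span[c ->]; rewrite mulr_suml linear_sum big1 //= => i _.
by rewrite -scalerAl linearZ /= orth_p (ltn_eqF (ltn_ord i)) mulr0.
Qed.

(** By Parseval, [L (P * P)] is the sum of the squares of the coefficients [L (P * p j)], which
    vanish together only for [P = 0]. Positivity of the functional thus comes from orthonormality
    itself. *)
Lemma ortho_pos (P : {poly F}) : P != 0 -> 0 < L (P * P).
Proof.
move=> P0; have PE := ortho_expansion (leqnn (size P)).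
have LE : L (P * P) = \sum_(j < size P) L (P * p j) ^+ 2.
  rewrite {2}PE mulr_sumr linear_sum; apply: eq_bigr => j _ /=.
  by rewrite -scalerAr linearZ.
rewrite lt_def LE sumr_ge0 ?andbT => [|j _]; last exact: sqr_ge0.
apply: contra P0; rewrite psumr_eq0 => [/allP z|j _]; last exact: sqr_ge0.
apply/eqP; rewrite PE big1 // => j _.
have /eqP : L (P * p j) ^+ 2 == 0 by apply: z; rewrite mem_index_enum.
by move=> /eqP; rewrite sqrf_eq0 => /eqP->; rewrite scale0r.
Qed.

(* If [p n = q ((X - a)^2 + b^2)], then [0 = L (p n q)] is
   [L ((q (X - a))^2) + b^2 L (q^2)], which is positive. *)
Lemma ortho_no_quadratic n (a b : F) :
  ~~ (('X - a%:P) ^+ 2 + (b ^+ 2)%:P %| p n).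
Proof.
have p0 : p n != 0 by rewrite -size_poly_eq0 size_p.
apply/negP => /dvdpP[q pE]; set Q := (_ + _) in pE.
have sQ : size Q = 3%N.
  by rewrite size_polyDl ?size_exp_XsubC // size_polyC; case: eqP.
have q0 : q != 0 by apply: contraNneq p0 => q0; rewrite pE q0 mul0r.
have Q0 : Q != 0 by rewrite -size_poly_eq0 sQ.
have sq : (size q <= n)%N.
  by move: (size_p n); rewrite pE size_mul // sQ addn3 => -[<-].
have := ortho_low sq; rewrite pE (_ : q * (q * Q) =
  (q * ('X - a%:P)) * (q * ('X - a%:P)) + b ^+ 2 *: (q * q)); last first.
  by rewrite /Q -mul_polyC; ring.
rewrite linearD linearZ /= => e.
have := ortho_pos (P := q * ('X - a%:P)).
rewrite mulf_neq0 ?polyXsubC_eq0 // => /(_ isT).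
have := mulr_ge0 (sqr_ge0 b) (ltW (ortho_pos q0)).
by move=> h1 h2; have := ltr_wpDl h1 h2; rewrite addrC e ltxx.
Qed.

(** Dividing out the real roots leaves a rootless cofactor. If it were not constant, it would have a
    divisor [(X - a)^2 + b^2]; a repeated root would give such a divisor with [b = 0]. Both are
    excluded for [p n]. *)
Lemma ortho_roots n :
  exists2 rs : seq F, uniq rs & p n = lead_coef (p n) *: \prod_(r <- rs) ('X - r%:P).
Proof.
have p0 : p n != 0 by rewrite -size_poly_eq0 size_p.
have [rs [g pE gr]] := prod_real_roots p0.
have sg : size g == 1%N.
  apply/negPn/negP => /rootless_quadratic_factor /(_ gr)[a [b]].
  move=> /(dvdp_mull (\prod_(r <- rs) ('X - r%:P))).
  by rewrite -pE; apply/negP/ortho_no_quadratic.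
have [c c0 gE] := size_poly1P _ sg.
exists rs.
  apply/negPn/negP => /(uniqPn 0)[i [j [ij jrs e]]].
  have irs := ltn_trans ij jrs.
  have /negP := ortho_no_quadratic n rs`_i 0; apply.
  rewrite expr0n addr0 pE dvdp_mulr //.
  rewrite (big_nth 0) big_mkord.
  rewrite (bigD1 (Ordinal irs)) //= (bigD1 (Ordinal jrs)) /=; last first.
    by rewrite -val_eqE /= gtn_eqF.
  by rewrite mulrA -e -expr2 dvdp_mulr.
rewrite {1}pE pE gE lead_coefM lead_coefC (monicP (monic_prod_XsubC _ _ _)).
by rewrite mul1r mulrC mul_polyC.
Qed.

(** The reproducing (Christoffel-Darboux) kernel with one variable frozen at [t]; its value at [t]
    is the inverse Christoffel number. *)
Definition ortho_kernel n t : {poly F} := \sum_(j < n) (p j).[t] *: p j.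

(* Write [p j = (p j).[t] + (X - t) s] and [p n = q (X - t)]; then
   [L (q p_j) = (p j).[t] L q] by orthogonality, so [q = L q * K_t]. *)
Lemma ortho_kernel_root n q t : p n = q * ('X - t%:P) -> (0 < n)%N ->
  q = L q *: ortho_kernel n t.
Proof.
move=> pE n0.
have p0 : p n != 0 by rewrite -size_poly_eq0 size_p.
have q0 : q != 0 by apply: contraNneq p0 => q0; rewrite pE q0 mul0r.
have sq : size q = n.
  by move: (size_p n); rewrite pE size_mul ?polyXsubC_eq0 // size_XsubC addn2 /= => -[].
have sqn : (size q <= n)%N by rewrite sq.
rewrite {1}(ortho_expansion sqn) scaler_sumr; apply: eq_bigr => j _.
rewrite scalerA; congr (_ *: _).
have /factor_theorem[s sE] : root (p j - (p j).[t]%:P) t.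
  by rewrite /root !hornerE subrr.
rewrite -[p j in LHS](subrK (p j).[t]%:P) sE mulrDr linearD /=.
rewrite [q * _%:P]mulrC mul_polyC linearZ /= [q * (s * _)]mulrCA -pE.
rewrite ortho_low ?add0r 1?mulrC //.
have [->|s0] := eqVneq s 0; first by rewrite size_poly0.
have: (size (s * ('X - t%:P))%R <= j.+1)%N.
  rewrite -sE (leq_trans (size_polyD _ _)) // size_p geq_max leqnn size_polyN.
  exact: leq_trans (size_polyC_leq1 _) _.
rewrite size_mul ?polyXsubC_eq0 // size_XsubC addn2 /= ltnS => /leq_trans; apply.
exact: ltnW.
Qed.

(** At a node [t] the kernel is a nonzero multiple of [p n / (X - t)], hence of the Lagrange basis
    polynomial of that node. *)
Lemma ortho_kernel_at_roots n rs (t u : F) : (0 < n)%N -> uniq rs ->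
  p n = lead_coef (p n) *: \prod_(r <- rs) ('X - r%:P) ->
  t \in rs -> u \in rs -> u != t -> (ortho_kernel n t).[u] = 0.
Proof.
move=> n0 urs pE trs ursu ut.
have lc0 : lead_coef (p n) != 0 by rewrite lead_coef_eq0 -size_poly_eq0 size_p.
pose q := lead_coef (p n) *: \prod_(r <- rem t rs) ('X - r%:P).
have pq : p n = q * ('X - t%:P).
  rewrite pE (perm_big _ (perm_to_rem trs)) big_cons /= /q.
  by rewrite -scalerAl [X in _ *: X]mulrC.
have qE := ortho_kernel_root pq n0.
have qt : q.[t] != 0.
  rewrite /q hornerZ mulf_neq0 // -[_ == _]/(root _ _) root_prod_XsubC.
  by rewrite mem_rem_uniqF.
have qu : q.[u] = 0.
  rewrite /q hornerZ; apply/eqP; rewrite mulf_eq0 (negPf lc0) /= -[_ == _]/(root _ _).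
  by rewrite root_prod_XsubC mem_rem_uniq // inE ut.
have Lq : L q != 0.
  by apply: contraNneq qt => Lq; rewrite qE Lq scale0r horner0.
by move: qu; rewrite qE hornerZ => /eqP; rewrite mulf_eq0 (negPf Lq) => /eqP.
Qed.

(** Modulo [p n], [P] keeps its values at the nodes, and also [L P], since the quotient has degree
    below [n] and is orthogonal to [p n]. The remainder [r] is interpolated by the kernels [K_t]:
    two polynomials of size at most [n] that agree at [n] distinct nodes coincide. As [L K_t = 1],
    the weights are [1 / K_t(t)]. *)
Lemma gauss_quadrature n rs (P : {poly F}) : (0 < n)%N -> uniq rs ->
  p n = lead_coef (p n) *: \prod_(r <- rs) ('X - r%:P) ->
  (size P <= n + n)%N ->
  L P = \sum_(t <- rs) P.[t] * (\sum_(j < n) (p j).[t] ^+ 2)^-1.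
Proof.
move=> n0 urs pE sP.
have pn0 : p n != 0 by rewrite -size_poly_eq0 size_p.
have lc0 : lead_coef (p n) != 0 by rewrite lead_coef_eq0.
have srs : size rs = n.
  by have := size_p n; rewrite pE size_scale // size_prod_XsubC => -[].
pose r := P %% p n.
have sr : (size r <= n)%N by rewrite -ltnS -(size_p n) ltn_modp.
have LPr : L P = L r.
  rewrite {1}(divp_eq P (p n)) linearD /= ortho_low ?add0r //.
  by rewrite size_divp // size_p leq_subLR.
have Pr t : t \in rs -> P.[t] = r.[t].
  move=> trs; rewrite {1}(divp_eq P (p n)) hornerD hornerM.
  suff -> : (p n).[t] = 0 by rewrite mulr0 add0r.
  by rewrite pE hornerZ (rootP (_ : root _ t)) ?mulr0 // root_prod_XsubC.
have p00 (t : F) : (p 0%N).[t] != 0.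
  have /size_poly1P[c c0 ->] : size (p 0%N) == 1%N by rewrite size_p.
  by rewrite hornerC.
have Ktt t : (ortho_kernel n t).[t] = \sum_(j < n) (p j).[t] ^+ 2.
  by rewrite horner_sum; apply: eq_bigr => j _; rewrite hornerZ expr2.
have Kt0 t : (ortho_kernel n t).[t] != 0.
  case: n n0 Ktt {pE srs sP pn0 lc0 r sr LPr Pr} => // n _ Ktt; rewrite Ktt.
  rewrite big_ord_recl /= gt_eqF // ltr_pwDl ?exprn_even_gt0 ?p00 //.
  by apply: sumr_ge0 => j _; apply: sqr_ge0.
(* [p 0] is a constant [c], so [L (p j)] is [1 / c] for [j = 0] and zero otherwise; only the term
   [c * (1 / c)] survives. *)
have LK t : L (ortho_kernel n t) = 1.
  case: n n0 {pE srs sP pn0 lc0 r sr LPr Pr Ktt Kt0} => // n _.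
  have /size_poly1P[c c0 cE] : size (p 0%N) == 1%N by rewrite size_p.
  have L0 j : L (p j) = (0%N == j)%:R / c.
    by rewrite -orth_p cE mul_polyC linearZ /= mulrC mulKf.
  rewrite linear_sum big_ord_recl big1 => [|j _];
    rewrite linearZ /= L0 ?mul0r ?mulr0 //.
  by rewrite cE hornerC addr0 mul1r divff.
have rE : r = \sum_(t <- rs) (r.[t] / (ortho_kernel n t).[t]) *: ortho_kernel n t.
  apply/eqP; rewrite -subr_eq0; apply/negPn/negP => /max_poly_roots.
  set d := (r - _) => /(_ rs) H.
  suff: (size rs < size d)%N.
    rewrite srs; apply/negP; rewrite -leqNgt (leq_trans (size_polyD _ _)) //.
    rewrite geq_max sr size_polyN /=.
    apply: leq_trans (size_sum _ _ _) _; apply/bigmax_leqP_seq => t _ _.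
    rewrite (leq_trans (size_scale_leq _ _)) //.
    apply: leq_trans (size_sum _ _ _) _; apply/bigmax_leqP => j _.
    by rewrite (leq_trans (size_scale_leq _ _)) // size_p.
  apply: H => //; apply/allP => u urs'; rewrite /root /d hornerD hornerN horner_sum.
  rewrite (bigD1_seq u) //= big1_seq => [|t /andP[tu trs]].
    by rewrite hornerZ divfK // addr0 subrr.
  by rewrite hornerZ (ortho_kernel_at_roots n0 urs pE trs urs') ?mulr0 // eq_sym.
rewrite LPr {1}rE linear_sum.
by apply: eq_big_seq => t trs; rewrite linearZ /= LK mulr1 Ktt Pr.
Qed.

End Gauss.

(** * Integration against the Jacobi weight as a linear functional *)

Section JacobiFunctional.
Variables (R : realType) (alpha beta : R) (p : nat -> {poly R}).
Hypothesis hp : orthonormal_jacobi alpha beta p.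

Let mu := [the measure _ _ of @lebesgue_measure R].
Let D : set (measurableTypeR R) := `](-1)%R, 1%R[.
Let mD : measurable D. Proof. exact: measurable_itv. Qed.
Let poly_weight (P : {poly R}) (x : measurableTypeR R) : R :=
  P.[x] * jweight alpha beta x.

Lemma measurable_jweight : measurable_fun D (jweight alpha beta).
Proof.
have m1 : measurable_fun D (fun x => 1 - x) by exact: measurable_funB.
have m2 : measurable_fun D (fun x => 1 + x) by exact: measurable_funD.
exact: measurable_funM (measurableT_comp (measurable_powR alpha) m1)
  (measurableT_comp (measurable_powR beta) m2).
Qed.

Lemma measurable_poly_jweight (P : {poly R}) : measurable_fun D (poly_weight P).
Proof.
apply: measurable_funM; last exact: measurable_jweight.
by apply: measurable_funTS; apply: continuous_measurable_fun; apply: continuous_horner.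
Qed.

(** Integrability is read off from orthonormality: since [p 0] is a nonzero constant, [P] is a
    combination of the products [p j * p 0], whose weighted integrals are finite. *)
Lemma integrable_poly_jweight (P : {poly R}) :
  mu.-integrable D (EFin \o poly_weight P).
Proof.
have [szp _ orth] := hp.
have [c PE] := ortho_span szp (leqnn (size P)).
have /size_poly1P[p0 p00 p0E] : size (p 0%N) == 1%N by rewrite szp.
have -> : EFin \o poly_weight P = (fun x => \sum_(j < size P)
    ((c j / p0)%:E * (poly_weight (p j * p 0%N) x)%:E)%E)%E.
  apply/funext => x; rewrite /= /poly_weight {1}PE horner_sum mulr_suml -sumEFin.
  apply: eq_bigr => j _; rewrite -EFinM; congr EFin.
  by rewrite p0E hornerZ hornerM hornerC; field.
apply: integrable_sum => [|j _]; first exact: mD.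
apply: (@integrableZl _ _ R mu D mD _
  (fun x => (poly_weight (p j * p 0%N) x)%:E)).
apply/integrableP; split.
  by apply/measurable_EFinP; apply: measurable_poly_jweight.
(* The integral is the difference of the integrals of the positive and negative parts, so it is a
   finite number only for an absolutely integrable function. *)
have := integral_fin_num_abs mu mD (measurable_poly_jweight (p j * p 0%N)).
move=> /= ->; rewrite /poly_weight.
by under eq_integral do rewrite hornerM; rewrite orth.
Qed.

Lemma jacobi_functional :
  exists L : {scalar {poly R}}, forall i j, L (p i * p j) = (i == j)%:R.
Proof.
have [_ _ orth] := hp.
pose L0 (P : {poly R}) := Rintegral mu D (poly_weight P).
have L0lin : scalar L0.
  move=> a P Q; rewrite /L0 /poly_weight.
  have iP := integrable_poly_jweight P; have iQ := integrable_poly_jweight Q.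
  rewrite -(@RintegralZl _ _ R mu D _ a mD iP).
  rewrite -(@RintegralD _ _ R mu D _ _ mD (@integrableZl _ _ R mu D mD a _ iP) iQ).
  by apply: eq_Rintegral => x _; rewrite /poly_weight hornerD hornerZ mulrDl -mulrA.
pose L : {scalar {poly R}} :=
  HB.pack L0 (GRing.isLinear.Build R {poly R} R *%R L0 L0lin).
exists L => i j; rewrite /L /= /L0 /Rintegral /poly_weight.
by under eq_integral do rewrite hornerM; rewrite orth.
Qed.

End JacobiFunctional.

(** * Linearity and polynomial reproduction of the discrete VP operator *)

Section VP.
Variables (R : realType) (alpha beta : R) (p : nat -> {poly R}).
Hypothesis hp : orthonormal_jacobi alpha beta p.

(** Turns the sum over the set of real zeros into a sum over a duplicate-free list, the same list
    that factors [p n] and carries the quadrature rule. *)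
Lemma vp_opE n : exists2 rs : seq R,
  uniq rs /\ p n = lead_coef (p n) *: \prod_(r <- rs) ('X - r%:P) &
  forall m f x, vp_op p n m f x = \sum_(t <- rs) (f t * christoffel p n t *
     \sum_(j < n + m) vp_coef R n m j * (p j).[x] * (p j).[t]).
Proof.
have [szp _ _] := hp; have [L orth] := jacobi_functional hp.
have [rs urs pE] := ortho_roots szp orth n; exists rs => // m f x.
rewrite fsbig_seq // /vp_op.
suff -> : [set t | root (p n) t] = [set` rs] by [].
apply/funext => t /=.
have lc0 : lead_coef (p n) != 0 by rewrite lead_coef_eq0 -size_poly_eq0 szp.
by rewrite /mkset pE rootZ // root_prod_XsubC.
Qed.

Lemma vp_op_poly n m f :
  exists2 Q : {poly R}, (size Q <= n + m)%N & vp_op p n m f = horner Q.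
Proof.
have [szp _ _] := hp; have [rs _ VE] := vp_opE n.
exists (\sum_(t <- rs) (f t * christoffel p n t) *:
    \sum_(j < n + m) (vp_coef R n m j * (p j).[t]) *: p j).
  apply: leq_trans (size_sum _ _ _) _; apply/bigmax_leqP_seq => t _ _.
  rewrite (leq_trans (size_scale_leq _ _)) //.
  apply: leq_trans (size_sum _ _ _) _; apply/bigmax_leqP => j _.
  by rewrite (leq_trans (size_scale_leq _ _)) // szp.
apply/funext => x; rewrite VE horner_sum; apply: eq_bigr => t _.
rewrite hornerZ horner_sum; congr (_ * _); apply: eq_bigr => j _.
by rewrite hornerZ mulrAC.
Qed.

Lemma vp_opB n m f g : vp_op p n m (f \- g) = vp_op p n m f \- vp_op p n m g.
Proof.
have [rs _ VE] := vp_opE n; apply/funext => x /=; rewrite !VE -sumrB.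
by apply: eq_bigr => t _; rewrite !mulrBl.
Qed.

(** For [j < n + m] the degree of [P * p j] is at most [(n - m) + (n + m - 1) = 2n - 1], the
    exactness range of the Gauss rule, so the sum over the nodes is [L (P * p j)]. For [j <= n - m]
    the VP coefficient is 1; for larger [j] this Fourier coefficient of [P] is zero. *)
Lemma vp_op_id n m (P : {poly R}) : (0 < m)%N -> (m < n)%N ->
  (size P <= (n - m).+1)%N ->
  vp_op p n m (horner P) = horner P.
Proof.
move=> m0 mn sP; have [szp _ _] := hp; have [L orth] := jacobi_functional hp.
have [rs [urs pE] VE] := vp_opE n; apply/funext => x.
have n0 : (0 < n)%N by apply: leq_ltn_trans mn.
transitivity (\sum_(j < n + m) vp_coef R n m j * (p j).[x] * L (P * p j)).
  rewrite VE; under eq_bigr do rewrite mulr_sumr.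
  rewrite exchange_big; apply: eq_bigr => j _ /=.
  rewrite (gauss_quadrature szp orth n0 urs pE).
    by rewrite mulr_sumr; apply: eq_bigr => t _; rewrite hornerM /christoffel; ring.
  have [->|P0] := eqVneq P 0; first by rewrite mul0r size_poly0.
  rewrite (leq_trans (size_polyMleq _ _)) // szp addnS /=.
  apply: (@leq_trans ((n - m).+1 + j)); first by rewrite leq_add2r.
  rewrite addSnnS (leq_trans (leq_add (leqnn _) (ltn_ord j))) //.
  by rewrite addnCA subnK ?leq_add2l // ltnW.
rewrite [in RHS](ortho_expansion szp orth sP) horner_sum.
have le : ((n - m).+1 <= n + m)%N by rewrite -addn1 leq_add ?leq_subr.
rewrite (big_ord_widen (n + m) (fun j => (L (P * p j) *: p j).[x]) le).
rewrite [RHS]big_mkcond /=.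
apply: eq_bigr => j _; rewrite ltnS /vp_coef; case: leqP => jn.
  by rewrite mul1r hornerZ mulrC.
by rewrite (ortho_low szp orth) ?mulr0 // (leq_trans sP).
Qed.
End VP.

(** * Power sums *)

Section PowerSums.
Variable R : realType.
Implicit Types (r s : R) (k M : nat).

Definition power_sum s M : R := \sum_(1 <= k < M) k.+1%:R `^ (s - 1).

Lemma power_sum_ge0 s M : 0 <= power_sum s M.
Proof. by apply: sumr_ge0 => k _; apply: powR_ge0. Qed.

(** This is [ln (1 + x) <= x] at [x = - 1 / (k + 1)]; the companion upper bound takes
    [x = 1 / k <= 2 / (k + 1)]. Telescoping such steps replaces the comparison of sums with
    integrals. *)
Lemma ln_step_ge k : (0 < k)%N -> k.+1%:R^-1 <= ln k.+1%:R - ln k%:R :> R.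
Proof.
move=> k0; have k0' : 0 < k%:R :> R by rewrite ltr0n.
have k1 : 0 < k.+1%:R :> R by rewrite ltr0n.
rewrite -lerN2 opprB -ln_div ?posrE //.
have -> : k%:R / k.+1%:R = 1 + - k.+1%:R^-1 :> R.
  by rewrite -natr1 in k1 *; field; rewrite gt_eqF.
by apply: le_ln1Dx; rewrite ltrN2 invf_lt1 // ltr1n.
Qed.

Lemma ln_step_le k : (0 < k)%N -> ln k.+1%:R - ln k%:R <= 2 / k.+1%:R :> R.
Proof.
move=> k0; have k0' : 0 < k%:R :> R by rewrite ltr0n.
have k1 : 0 < k.+1%:R :> R by rewrite ltr0n.
rewrite -ln_div ?posrE // -natr1 mulrDl mul1r divff ?lt0r_neq0 //.
have kV : 0 < k%:R^-1 :> R by rewrite invr_gt0.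
apply: le_trans (le_ln1Dx _) _; first lra.
rewrite ler_pdivlMr ?natr1 // mulrC ler_pdivrMr // -natr1.
have : 1 <= k%:R :> R by rewrite ler1n.
lra.
Qed.

Lemma powR_succB1 s k : k.+1%:R `^ (s - 1) = k.+1%:R `^ s / k.+1%:R :> R.
Proof. by rewrite powRB ?pnatr_eq0 ?implybT // powRr1. Qed.

Lemma powR_expR s k : (0 < k)%N -> k%:R `^ s = expR (s * ln k%:R) :> R.
Proof. by move=> k0; rewrite /powR gt_eqF // ltr0n. Qed.

(** With [u = s (ln (k + 1) - ln k) >= s / (k + 1)], the increment of the power is
    [k^s (e^u - 1) >= k^s u]. The factor [2^s] is the cost of replacing [k^s] by [(k + 1)^s], and it
    makes the bound independent of the sign of [s - 1]. *)
Lemma powR_step_ge s k : 0 < s -> (0 < k)%N ->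
  k.+1%:R `^ (s - 1) <= 2 `^ s / s * (k.+1%:R `^ s - k%:R `^ s) :> R.
Proof.
move=> s0 k0.
have k2 : k.+1%:R `^ s <= 2 `^ s * k%:R `^ s :> R.
  rewrite -powRM // ge0_ler_powR ?nnegrE ?(ltW s0) //.
  by rewrite -natrM ler_nat mul2n -addnn -addn1 leq_add2l.
rewrite powR_succB1 mulrAC ler_pdivlMr // mulrAC ler_pdivrMr ?ltr0n //.
have st : k%:R `^ s * s <= (k.+1%:R `^ s - k%:R `^ s) * k.+1%:R :> R.
  rewrite -ler_pdivrMr ?ltr0n // !powR_expR //.
  rewrite -[s * ln k.+1%:R](subrK (s * ln k%:R)) expRD.
  rewrite -[X in _ <= _ - X]mul1r -mulrBl -mulrA mulrC ler_wpM2r ?expR_ge0 //.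
  rewrite lerBrDl; apply: le_trans (expR_ge1Dx _).
  rewrite lerD2l -mulrBr ler_wpM2l ?(ltW s0) //.
  exact: ln_step_ge.
apply: le_trans (ler_wpM2r (ltW s0) k2) _.
by rewrite -!mulrA ler_wpM2l ?powR_ge0.
Qed.

(** With the same [u], the increment is [(k + 1)^s (1 - e^(-u)) <= (k + 1)^s u], and
    [u <= 2 s / (k + 1)]. *)
Lemma powR_step_le s k : 0 < s -> (0 < k)%N ->
  k.+1%:R `^ s - k%:R `^ s <= 2 * s * k.+1%:R `^ (s - 1) :> R.
Proof.
move=> s0 k0; rewrite powR_succB1 mulrCA !powR_expR //.
rewrite -[s * ln k%:R](subrK (s * ln k.+1%:R)) expRD.
rewrite -[X in X - _]mul1r -mulrBl mulrC ler_wpM2l ?expR_ge0 //.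
rewrite lerBlDl -lerBlDr; apply: le_trans (expR_ge1Dx _); rewrite lerD2l.
rewrite -opprB lerN2 -mulrBr [2 * s]mulrC -mulrA ler_wpM2l ?(ltW s0) //.
exact: ln_step_le.
Qed.

Lemma power_sum_le s M : 0 < s -> (0 < M)%N ->
  power_sum s M <= 2 `^ s / s * M%:R `^ s.
Proof.
move=> s0 M0; rewrite /power_sum.
apply: (@le_trans _ _ (\sum_(1 <= k < M) 2 `^ s / s * (k.+1%:R `^ s - k%:R `^ s))).
  by rewrite !big_nat; apply: ler_sum => k /andP[k0 _]; apply: powR_step_ge.
rewrite -mulr_sumr telescope_sumr // ler_wpM2l ?divr_ge0 ?powR_ge0 ?(ltW s0) //.
by rewrite lerBlDr lerDl powR_ge0.
Qed.

Lemma power_sum0_le M : (0 < M)%N -> power_sum 0 M <= ln M%:R.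
Proof.
move=> M0; rewrite /power_sum.
apply: (@le_trans _ _ (\sum_(1 <= k < M) (ln k.+1%:R - ln k%:R))).
  rewrite !big_nat; apply: ler_sum => k /andP[k0 _].
  by rewrite sub0r powR_inv1 // ln_step_ge.
by rewrite telescope_sumr // ln1 subr0.
Qed.

Lemma power_sum_ge s M : 0 < s -> (0 < M)%N ->
  M%:R `^ s <= 1 + 2 * s * power_sum s M.
Proof.
move=> s0 M0; rewrite -lerBlDl.
have <- : \sum_(1 <= k < M) (k.+1%:R `^ s - k%:R `^ s) = M%:R `^ s - 1 :> R.
  by rewrite telescope_sumr // powR1.
rewrite /power_sum mulr_sumr !big_nat; apply: ler_sum => k /andP[k0 _].
exact: powR_step_le.
Qed.

Lemma power_sum0_ge M : (0 < M)%N -> ln M%:R <= 2 * power_sum 0 M.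
Proof.
move=> M0.
have <- : \sum_(1 <= k < M) (ln k.+1%:R - ln k%:R) = ln M%:R :> R.
  by rewrite telescope_sumr // ln1 subr0.
rewrite /power_sum mulr_sumr !big_nat; apply: ler_sum => k /andP[k0 _].
by rewrite sub0r powR_inv1 // ln_step_le.
Qed.

Lemma power_sum_mono s M : 0 <= s -> power_sum 0 M <= power_sum s M.
Proof.
move=> s0; apply: ler_sum => k _; apply: ler_powR; first by rewrite ler1n.
by rewrite lerD2r.
Qed.

(** Meant for [M = n + m] and [q = n - m], both comparable to [n]: the upper bound for the sum at
    [M] is matched with the lower bound at [q + 1]. The summand 1 absorbs additive constants. *)
Lemma power_sum_doubling s (c : R) : 0 <= s -> 0 < c -> exists2 K : R, 0 < K &
  forall n q M, (0 < M)%N -> M%:R <= 2 * n%:R :> R -> c * n%:R <= q.+1%:R ->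
    1 + power_sum s M <= K * (1 + power_sum s q.+1).
Proof.
move=> s0 c0; have [s00|sp] := eqVneq s 0.
  (* Here [S_0(M) <= ln M <= ln (2 / c) + ln (q + 1) <= |ln (2 / c)| + 2 S_0(q + 1)]. *)
  exists (3 + `|ln (2 / c)|); first by have := normr_ge0 (ln (2 / c)); lra.
  move=> n q M M0 Mn nq; rewrite s00.
  have h1 := power_sum0_le M0; have h2 := power_sum0_ge (ltn0Sn q).
  have h3 : ln M%:R <= ln (2 / c) + ln q.+1%:R :> R.
    rewrite -lnM ?posrE ?divr_gt0 ?ltr0n // ler_ln ?posrE ?mulr_gt0 ?invr_gt0 ?ltr0n //.
    by apply: le_trans Mn _; rewrite -mulrA ler_wpM2l // mulrC ler_pdivlMr // mulrC.
  have h4 := ler_norm (ln (2 / c)).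
  have h5 := power_sum_ge0 0 q.+1.
  have h6 := mulr_ge0 (normr_ge0 (ln (2 / c))) h5.
  nra.
have {}s0 : 0 < s by rewrite lt_def sp.
(* From [M <= (2 / c) (q + 1)] one gets [S_s(M) <= a (q + 1)^s], and [(q + 1)^s <= 1 + 2 s S_s(q +
   1) <= (1 + 2 s) (1 + S_s(q + 1))]. *)
pose a := 2 `^ s / s * (2 / c) `^ s.
have a0 : 0 <= a by rewrite mulr_ge0 ?divr_ge0 ?powR_ge0 ?(ltW s0).
exists (1 + a * (1 + 2 * s)).
  by rewrite ltr_pwDl // mulr_ge0 // addr_ge0 // mulr_ge0 // ltW.
move=> n q M M0 Mn nq.
have h1 := power_sum_le s0 M0; have h2 := power_sum_ge s0 (ltn0Sn q).
have h5 := power_sum_ge0 s q.+1.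
have h3 : power_sum s M <= a * q.+1%:R `^ s.
  have c2 : 0 <= 2 / c by rewrite divr_ge0 // ltW.
  apply: le_trans h1 _; rewrite /a -[leRHS]mulrA -powRM //.
  apply: ler_wpM2l; first by rewrite divr_ge0 ?powR_ge0 // ltW.
  apply: ge0_ler_powR; rewrite ?nnegrE ?(ltW s0) //; first exact: mulr_ge0.
  by apply: le_trans Mn _; rewrite -mulrA ler_wpM2l // mulrC ler_pdivlMr // mulrC.
have h6 : a * q.+1%:R `^ s <= a * ((1 + 2 * s) * (1 + power_sum s q.+1)).
  apply: ler_wpM2l => //; apply: le_trans h2 _.
  have := mulr_ge0 (ltW s0) h5; nra.
nra.
Qed.

End PowerSums.

(** * Weighted approximation and Besov norms *)

Section Weighted.
Variables (R : realType) (gamma delta : R).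
Hypotheses (hgamma : 0 <= gamma) (hdelta : 0 <= delta).
Implicit Types (f g : R -> R) (P Q : {poly R}).
Local Notation N := (wnorm gamma delta).
Local Notation E := (best_approx gamma delta).
Local Notation v := (jweight gamma delta).

Lemma jweight_ge0 x : 0 <= v x.
Proof. by rewrite mulr_ge0 ?powR_ge0. Qed.

Lemma continuous_powR_pos (a b : R) : 0 < b -> {for b, continuous (@powR R ^~ a)}.
Proof.
move=> b0; apply: differentiable_continuous; apply/derivable1_diffP.
by apply: derivable_powR; rewrite in_itv /= b0.
Qed.

(** The assumed operator bound speaks of members of the space only and will be applied to [f - P];
    also, the image of the operator consists of polynomials. *)
Lemma C0v_horner P : C0v gamma delta (horner P).
Proof.
split=> [x _||]; first exact: continuous_horner.
- case: ifP => g0; last by apply: cvg_at_left_filter; exact: continuous_horner.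
  rewrite -(mulr0 P.[1]) -(mul0r ((1 + 1) `^ delta)).
  apply: cvgM; first by apply: cvg_at_left_filter; exact: continuous_horner.
  apply: cvgM.
    (* Substituting [x = 1 - e] turns the vanishing factor of the weight into [e^gamma] as [e] tends
       to 0 from the right. *)
    move=> A /(powR_cvg0 g0) A0; apply/nbhs_left0P.
    by near=> e; rewrite /= opprB addrCA subrr addr0; near: e.
  apply: cvg_at_left_filter.
  apply: (@cvg_comp _ _ _ (fun x => 1 + x) (@powR R ^~ delta) _ (nbhs (1 + 1 : R))).
    by apply: cvgD; [exact: cvg_cst|exact: cvg_id].
  by apply: continuous_powR_pos.
- case: ifP => g0; last by apply: cvg_at_right_filter; exact: continuous_horner.
  rewrite -(mulr0 P.[-1]) -(mulr0 ((1 - -1) `^ gamma)).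
  apply: cvgM; first by apply: cvg_at_right_filter; exact: continuous_horner.
  apply: cvgM; last first.
    move=> A /(powR_cvg0 g0) A0; apply/nbhs_right0P.
    by near=> e; rewrite /= addrA subrr add0r; near: e.
  apply: cvg_at_right_filter.
  apply: (@cvg_comp _ _ _ (fun x => 1 - x) (@powR R ^~ gamma) _ (nbhs (1 - -1 : R))).
    by apply: cvgB; [exact: cvg_cst|exact: cvg_id].
  by apply: continuous_powR_pos; rewrite opprK.
Unshelve. all: by end_near. Qed.

Lemma C0vB f g : C0v gamma delta f -> C0v gamma delta g -> C0v gamma delta (f \- g).
Proof.
move=> [fc f1 fm1] [gc g1 gm1]; split.
- by move=> x xi; apply: cvgB; [exact: fc|exact: gc].
- move: f1 g1; case: ifP => _ f1' g1'; last exact: cvgB.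
  have h : f x * v x - g x * v x @[x --> 1^'-] --> (0 - 0 : R) by exact: cvgB.
  by move: h; rewrite subr0; under eq_fun do rewrite -mulrBl.
- move: fm1 gm1; case: ifP => _ f1' g1'; last exact: cvgB.
  have h : f x * v x - g x * v x @[x --> (-1)^'+] --> (0 - 0 : R) by exact: cvgB.
  by move: h; rewrite subr0; under eq_fun do rewrite -mulrBl.
Qed.

Local Open Scope ereal_scope.

Lemma wnorm_ub f x : x \in `[(-1)%R, 1%R] -> (`|f x| * v x)%:E <= N f.
Proof. by move=> xi; apply: ereal_sup_ubound; exists x. Qed.

Lemma wnorm_leP f (M : \bar R) :
  (forall x, x \in `[(-1)%R, 1%R] -> (`|f x| * v x)%:E <= M) -> N f <= M.
Proof. by move=> h; apply: ge_ereal_sup => _ [x xi <-]; apply: h. Qed.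

Lemma wnorm_ge0 f : 0 <= N f.
Proof.
apply: le_trans (wnorm_ub f (_ : 0%R \in _)).
  by rewrite lee_fin mulr_ge0 ?jweight_ge0.
by rewrite in_itv /= lerN10 ler01.
Qed.

Lemma wnormB f g : N (f \- g)%R <= N f + N g.
Proof.
apply: wnorm_leP => x xi; apply: le_trans (leeD (wnorm_ub f xi) (wnorm_ub g xi)).
by rewrite -EFinD lee_fin -mulrDl ler_wpM2r ?jweight_ge0 // ler_normB.
Qed.

Lemma wnorm_triangle f g h : N (f \- h)%R <= N (f \- g)%R + N (g \- h)%R.
Proof.
apply: wnorm_leP => x xi.
apply: le_trans (leeD (wnorm_ub (f \- g)%R xi) (wnorm_ub (g \- h)%R xi)).
by rewrite -EFinD lee_fin -mulrDl ler_wpM2r ?jweight_ge0 //= ler_distD.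
Qed.

Lemma wnorm_subC f g : N (f \- g)%R = N (g \- f)%R.
Proof.
suff h f' g' : N (f' \- g')%R <= N (g' \- f')%R by apply/eqP; rewrite eq_le !h.
by apply: wnorm_leP => x xi /=; rewrite distrC; apply: (wnorm_ub (g' \- f')%R xi).
Qed.

Lemma wnorm0 : N (fun=> 0%R) = 0.
Proof.
apply/eqP; rewrite eq_le wnorm_ge0 andbT; apply: wnorm_leP => x _.
by rewrite normr0 mul0r.
Qed.

Lemma wnorm_horner_lty P : N (horner P) < +oo.
Proof.
have [K PK] := poly_itv_bound P (-1)%R 1%R.
apply: (@le_lt_trans _ _ (K * (2 `^ gamma * 2 `^ delta))%:E); last exact: ltry.
apply: wnorm_leP => x xi; have := PK x; move: xi; rewrite in_itv /= lee_fin => xi.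
move=> /(_ xi) Px; apply: ler_pM => //; first exact: jweight_ge0.
move/andP: xi => [x1 x2].
by apply: ler_pM; rewrite ?powR_ge0 // ge0_ler_powR ?nnegrE //; lra.
Qed.

Lemma best_approx_ge0 k f : 0 <= E k f.
Proof. by apply: le_ereal_inf_tmp => _ [P _ <-]; apply: wnorm_ge0. Qed.

Lemma best_approx_le k f P : (size P <= k.+1)%N -> E k f <= N (f \- horner P)%R.
Proof. by move=> sP; apply: ereal_inf_lbound; exists P. Qed.

Lemma best_approx_le_wnorm k f : E k f <= N f.
Proof.
have := @best_approx_le k f 0; rewrite size_poly0 => /(_ isT) /le_trans; apply.
by rewrite (_ : f \- _ = f)%R //; apply/funext => x /=; rewrite horner0 subr0.
Qed.

Lemma best_approx_anti k l f : (k <= l)%N -> E l f <= E k f.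
Proof.
move=> kl; apply: le_ereal_inf_tmp => _ [P /= sP <-]; apply: best_approx_le.
exact: leq_trans sP _.
Qed.

Lemma best_approx_horner k P : (size P <= k.+1)%N -> E k (horner P) = 0.
Proof.
move=> sP; apply/eqP; rewrite eq_le best_approx_ge0 andbT.
apply: le_trans (best_approx_le _ sP) _.
by rewrite (_ : (_ \- _)%R = fun=> 0%R) ?wnorm0 //; apply/funext => x /=; rewrite subrr.
Qed.

Lemma best_approx_sub_horner k f P : (size P <= k.+1)%N ->
  E k (f \- horner P)%R <= E k f.
Proof.
move=> sP; apply: le_ereal_inf_tmp => _ [Q /= sQ <-].
have sQP : (size (Q - P)%R <= k.+1)%N.
  by rewrite (leq_trans (size_polyD _ _)) // geq_max sQ size_polyN.
apply: le_trans (best_approx_le _ sQP) _.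
rewrite (_ : (_ \- horner (Q - P))%R = (f \- horner Q)%R) //.
by apply/funext => x /=; rewrite hornerD hornerN opprB addrA subrK.
Qed.

Lemma best_approx_perturb k f g : E k f <= E k g + N (f \- g)%R.
Proof.
have [->|] := eqVneq (N (f \- g)%R) +oo.
  by rewrite addey ?leey // gt_eqF // (lt_le_trans (ltNyr 0)) // best_approx_ge0.
rewrite -ltey => Nfin.
have fin : N (f \- g)%R \is a fin_num by rewrite ge0_fin_numE ?wnorm_ge0.
rewrite -leeBlDr //; apply: le_ereal_inf_tmp => _ [P /= sP <-].
rewrite leeBlDr // addeC; apply: le_trans (best_approx_le _ sP) _.
exact: wnorm_triangle.
Qed.

Lemma le_best_approx (c : R) k f (M : \bar R) : (0 < c)%R ->
  (forall P, (size P <= k.+1)%N -> M <= c%:E * N (f \- horner P)%R) ->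
  M <= c%:E * E k f.
Proof.
move=> c0 h; rewrite -[c in c%:E]invrK -lee_pdivrMl ?invr_gt0 //.
apply: le_ereal_inf_tmp => _ [P /= sP <-]; rewrite lee_pdivrMl ?invr_gt0 // invrK.
exact: h.
Qed.

(** At [M = 1] this is [besov_sum] by conversion, so a single splitting lemma serves the sum and its
    tails. *)
Definition besov_tail s M f :=
  \sum_(M <= k <oo) (k.+1%:R `^ (s - 1))%:E * E k f.

Lemma besov_term_ge0 s k f : 0 <= (k.+1%:R `^ (s - 1))%:E * E k f.
Proof. by rewrite mule_ge0 ?best_approx_ge0 // lee_fin powR_ge0. Qed.

Lemma besov_tail_ge0 s M f : 0 <= besov_tail s M f.
Proof. by apply: nneseries_ge0 => k _ _; apply: besov_term_ge0. Qed.

Lemma besov_sum_split s L M f : (L <= M)%N -> besov_tail s L f =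
  \sum_(L <= k < M) (k.+1%:R `^ (s - 1))%:E * E k f + besov_tail s M f.
Proof.
move=> LM; rewrite /besov_tail -(subnKC LM).
by apply: nneseries_split => k _; apply: besov_term_ge0.
Qed.

Lemma besov_tail_le s M f : (0 < M)%N -> besov_tail s M f <= besov_sum gamma delta s f.
Proof.
move=> M0; rewrite -[besov_sum _ _ _ _]/(besov_tail s 1 f) (besov_sum_split _ _ M0).
by rewrite leeDr // sume_ge0 // => k _; apply: besov_term_ge0.
Qed.

Lemma besov_norm_ge0 s f : 0 <= besov_norm gamma delta s f.
Proof. by rewrite adde_ge0 ?wnorm_ge0 //; apply: (besov_tail_ge0 s 1). Qed.

Lemma sum_powR_const s L M (A : \bar R) :
  \sum_(L <= k < M) (k.+1%:R `^ (s - 1))%:E * A =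
  (\sum_(L <= k < M) k.+1%:R `^ (s - 1))%R%:E * A.
Proof.
by rewrite -sumEFin ge0_sume_distrl // => k _; rewrite lee_fin powR_ge0.
Qed.

Lemma besov_tail_mono (c s r : R) M f g : (0 <= c)%R ->
  (forall k, (M <= k)%N ->
     (k.+1%:R `^ (s - 1))%:E * E k g <= c%:E * ((k.+1%:R `^ (r - 1))%:E * E k f)) ->
  besov_tail s M g <= c%:E * besov_tail r M f.
Proof.
move=> c0 h; rewrite /besov_tail -nneseriesZl => [|k _]; last exact: besov_term_ge0.
have h0 k := mule_ge0 (_ : 0 <= c%:E) (besov_term_ge0 r k f).
rewrite -[leLHS]nneseries_addn => [|k]; last exact: besov_term_ge0.
rewrite -[leRHS]nneseries_addn => [|k]; last by rewrite h0 ?lee_fin.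
apply: lee_nneseries => [k _ _|k _]; first exact: besov_term_ge0.
by apply: h; rewrite leq_addl.
Qed.

(** Below [M] each best approximation error of [g] is at most [N g], hence at most [A]; together
    with the norm itself this gives the factor [1 + S_s(M)]. From [M] on, [f] dominates termwise. *)
Lemma besov_norm_cut s M f g (A : \bar R) : (0 < M)%N -> N g <= A ->
  (forall k, (M <= k)%N -> E k g <= E k f) ->
  besov_norm gamma delta s g <= (1 + power_sum s M)%:E * A + besov_tail s M f.
Proof.
move=> M0 gA gf; have A0 := le_trans (wnorm_ge0 g) gA.
rewrite /besov_norm -[besov_sum _ _ _ _]/(besov_tail s 1 g).
rewrite (besov_sum_split _ _ M0) addeA.
apply: leeD; last first.
  rewrite -[X in _ <= X]mul1e; apply: besov_tail_mono => // k Mk.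
  by rewrite mul1e lee_wpmul2l ?gf // lee_fin powR_ge0.
rewrite EFinD ge0_muleDl ?lee_fin ?power_sum_ge0 // mul1e leeD //.
rewrite /power_sum -sum_powR_const; apply: lee_sum => k _.
rewrite lee_wpmul2l ?lee_fin ?powR_ge0 //.
exact: le_trans (best_approx_le_wnorm _ _) gA.
Qed.

(** Errors decrease with the degree, so every term with [k <= q] has an error of at least
    [E q f]. *)
Lemma best_approx_power_sum s L q f : (L <= q.+1)%N ->
  (\sum_(L <= k < q.+1) k.+1%:R `^ (s - 1))%R%:E * E q f <= besov_tail s L f.
Proof.
move=> Lq; rewrite (besov_sum_split _ _ Lq) -sum_powR_const.
apply: le_trans (leeDl _ (besov_tail_ge0 _ _ _)).
rewrite !big_nat; apply: lee_sum => k /andP[_ kq].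
by rewrite lee_wpmul2l ?lee_fin ?powR_ge0 // best_approx_anti.
Qed.

Lemma best_approx_besov_norm s q f :
  (1 + power_sum s q.+1)%:E * E q f <= besov_norm gamma delta s f.
Proof.
rewrite EFinD ge0_muleDl ?lee_fin ?power_sum_ge0 // mul1e.
by apply: leeD; [exact: best_approx_le_wnorm|exact: best_approx_power_sum].
Qed.

(** The weight of the term [k = 1] is positive, so [E 1 f] is finite; some polynomial is then at
    finite distance from [f], and polynomials have finite weighted norm. *)
Lemma besov_wnorm_lty s f : besov_sum gamma delta s f < +oo -> N f < +oo.
Proof.
move=> Bf; have : E 1 f < +oo.
  rewrite ltey; apply: contraTneq Bf => E1.
  rewrite -[besov_sum _ _ _ _]/(besov_tail s 1 f) (besov_sum_split _ _ (leqnSn 1)).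
  rewrite big_nat1 E1 mulry gtr0_sg ?powR_gt0 // mul1e addye //.
  by rewrite gt_eqF // (lt_le_trans (ltNyr 0)) // besov_tail_ge0.
move=> /ereal_inf_ltP [_ [P /= _ <-] NP].
apply: le_lt_trans (lte_add_pinfty NP (wnorm_horner_lty P)).
rewrite {1}(_ : f = ((f \- horner P) \- (fun x => - P.[x]))%R); last first.
  by apply/funext => x /=; rewrite opprK subrK.
apply: le_trans (wnormB _ _) _; apply: leeD => //.
by apply: wnorm_leP => x xi; rewrite normrN wnorm_ub.
Qed.

Lemma besov_norm_fin s f : besov_sum gamma delta s f < +oo ->
  besov_norm gamma delta s f \is a fin_num.
Proof.
move=> Bf; rewrite ge0_fin_numE ?besov_norm_ge0 //.
exact: lte_add_pinfty (besov_wnorm_lty Bf) Bf.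
Qed.

Lemma besov_tail_small s f (e : R) : (0 < e)%R -> besov_sum gamma delta s f < +oo ->
  exists2 L, (0 < L)%N & forall M, (L <= M)%N -> besov_tail s M f <= e%:E.
Proof.
move=> e0 Bf.
have : besov_tail s 0 f < +oo.
  (* The tail convergence used below concerns series from index 0; the extra term is [E 0 f],
     bounded by the norm of [f]. *)
  rewrite (besov_sum_split _ _ (leqnSn 0)) big_nat1; apply: (lte_add_pinfty _ Bf).
  rewrite powR1 mul1e; apply: le_lt_trans (best_approx_le_wnorm _ _) _.
  exact: besov_wnorm_lty Bf.
move=> /nneseries_tail_cvg /(_ (fun k _ => besov_term_ge0 s k f)) tail0.
have [L _ hL] := tail0 _ (@nbhs_open_ereal_lt _ 0%R (fun=> e) e0).
exists L.+1 => // M LM; apply: ltW; apply: hL; exact: ltnW.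
Qed.

(** The power sum is cut at a fixed [j]. The part from [j] on, times [E q f], is at most a tail of
    the convergent Besov sum. The part before [j] is constant, while [E q f] tends to 0, being at
    most the Besov norm divided by a sum that grows at least like [ln q]. *)
Lemma best_approx_power_sum_small s f (e : R) : (0 <= s)%R -> (0 < e)%R ->
  besov_sum gamma delta s f < +oo ->
  exists L, forall q, (L <= q)%N -> (1 + power_sum s q.+1)%:E * E q f <= e%:E.
Proof.
move=> s0 e0 Bf; have e20 : (0 < e / 2)%R by rewrite divr_gt0.
have [j j0 tailj] := besov_tail_small e20 Bf.
pose B := fine (besov_norm gamma delta s f).
have BE : besov_norm gamma delta s f = B%:E by rewrite fineK // besov_norm_fin.
have B0 : (0 <= B)%R by rewrite fine_ge0 // besov_norm_ge0.
(* Once [ln (q + 1) >= Y], the error [x] satisfies [x Y <= 2 x S_s(q + 1) <= 2 (B + 1)], which is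
   exactly [x (1 + S_s(j)) <= e / 2]; [B + 1] instead of [B] can be cancelled. *)
pose Y : R := (4 * (B + 1) * (1 + power_sum s j) / e)%R.
have Sj := power_sum_ge0 s j.
exists (maxn j (Num.bound (expR Y))) => q; rewrite geq_max => /andP[jq Yq].
have lnY : (Y <= ln q.+1%:R)%R.
  rewrite -ler_expR lnK ?posrE ?ltr0n //.
  apply: le_trans (ltW (archi_boundP (expR_ge0 Y))) _.
  by rewrite ler_nat (leq_trans Yq).
have Eq := best_approx_besov_norm s q f.
have E0 := best_approx_ge0 q f.
have Efin : E q f \is a fin_num.
  rewrite ge0_fin_numE //; apply: le_lt_trans (best_approx_le_wnorm _ _) _.
  exact: besov_wnorm_lty Bf.
pose x := fine (E q f); have xE : E q f = x%:E by rewrite fineK.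
have x0 : (0 <= x)%R by rewrite fine_ge0.
rewrite (_ : power_sum s q.+1 =
  power_sum s j + \sum_(j <= k < q.+1) k.+1%:R `^ (s - 1))%R; last first.
  by rewrite /power_sum -big_cat_nat // ltnW.
rewrite addrA EFinD ge0_muleDl ?lee_fin ?addr_ge0 ?sumr_ge0 //.
have -> : e%:E = (e / 2)%:E + (e / 2)%:E by rewrite -EFinD -splitr.
apply: leeD; last first.
  by apply: le_trans (best_approx_power_sum _ _ (ltnW _)) (tailj _ (leqnn j)).
move: Eq; rewrite xE BE -!EFinM !lee_fin => Eq.
have h1 := power_sum0_ge R (ltn0Sn q); have h2 := power_sum_mono q.+1 s0.
have h3 : (x * Y <= 2 * (B + 1))%R.
  have : (x * Y <= x * (2 * power_sum s q.+1))%R by apply: ler_wpM2l => //; lra.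
  by move: Eq; rewrite mulrDl mul1r; lra.
move: h3; rewrite /Y mulrA ler_pdivrMr // => h3.
rewrite ler_pdivlMr // -(ler_pM2l (_ : 0 < 2 * (B + 1))%R); last lra.
by apply: le_trans h3; rewrite le_eqVlt; apply/orP; left; apply/eqP; ring.
Qed.

(** Chains [(c n)^r <= (q + 1)^r <= (1 + 2 r) (1 + S_r(q + 1))] with the bound of
    [(1 + S_r(q + 1)) E q f] by the Besov norm. *)
Lemma best_approx_rate (r c : R) n q f : (0 < r)%R -> (0 < c)%R -> (0 < n)%N ->
  (c * n%:R <= q.+1%:R)%R ->
  E q f <= ((1 + 2 * r) / c `^ r / n%:R `^ r)%:E * besov_norm gamma delta r f.
Proof.
move=> r0 c0 n0 cn; have n0' : (0 < n%:R :> R)%R by rewrite ltr0n.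
have cnr : (0 < c `^ r * n%:R `^ r)%R by rewrite mulr_gt0 ?powR_gt0.
rewrite -mulrA -invfM mulrC EFinM -muleA lee_pdivlMl //.
have r2 : (0 <= 1 + 2 * r)%R by lra.
apply: le_trans (lee_wpmul2l _ (best_approx_besov_norm r q f)); last by rewrite lee_fin.
rewrite muleA -EFinM lee_wpmul2r ?best_approx_ge0 // lee_fin -powRM ?(ltW c0) //.
apply: (@le_trans _ _ (q.+1%:R `^ r)%R).
  by apply: ge0_ler_powR; rewrite ?nnegrE ?(ltW r0) // mulr_ge0 // ltW.
apply: le_trans (power_sum_ge r0 (ltn0Sn q)) _.
by have := power_sum_ge0 r q.+1; nra.
Qed.

(** In the tail [k + 1 >= n], so trading the exponent [s - 1] for [r - 1] gains the factor
    [n^(s - r)] in each term. *)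
Lemma besov_tail_rate (r s : R) n M f : (s <= r)%R -> (0 < n)%N -> (n <= M)%N ->
  besov_tail s M f <= (n%:R `^ (r - s))^-1%:E * besov_tail r M f.
Proof.
move=> sr n0 nM; apply: besov_tail_mono => [|k Mk]; first by rewrite invr_ge0 powR_ge0.
rewrite muleA -EFinM lee_wpmul2r ?best_approx_ge0 // lee_fin.
rewrite ler_pdivlMl ?powR_gt0 ?ltr0n //.
rewrite [(r - 1)%R](_ : _ = (r - s) + (s - 1))%R; last by ring.
rewrite [leRHS]powRD ?pnatr_eq0 ?implybT // ler_wpM2r ?powR_ge0 //.
rewrite ge0_ler_powR ?nnegrE ?subr_ge0 // ler_nat.
exact: leq_trans nM (leq_trans Mk _).
Qed.

(** * Bounded operators with polynomial values that reproduce low degrees *)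

Section Operator.
Variables (V : (R -> R) -> R -> R) (q M : nat) (C : R).
Hypotheses (C0 : (0 < C)%R) (M0 : (0 < M)%N).
Hypothesis V_poly : forall f,
  exists2 Q : {poly R}, (size Q <= M)%N & V f = horner Q.
Hypothesis VB : forall f g, V (f \- g)%R = (V f \- V g)%R.
Hypothesis V_id : forall P : {poly R}, (size P <= q.+1)%N -> V (horner P) = horner P.
Hypothesis V_bounded : forall f, C0v gamma delta f -> N (V f) <= C%:E * N f.

(** Lebesgue's argument: [f - V f = (f - P) - V (f - P)] for every [P] of degree at most [q]. *)
Lemma operator_error f : C0v gamma delta f ->
  N (f \- V f)%R <= (1 + C)%:E * E q f.
Proof.
move=> fC; apply: le_best_approx; first by rewrite addr_gt0.
move=> P sP.
rewrite (_ : (f \- V f)%R = ((f \- horner P) \- V (f \- horner P))%R); last first.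
  by apply/funext => x; rewrite VB V_id //=; ring.
apply: le_trans (wnormB _ _) _.
rewrite EFinD ge0_muleDl ?lee_fin ?(ltW C0) // mul1e leeD //.
by apply: V_bounded; apply: C0vB => //; apply: C0v_horner.
Qed.

Lemma operator_error_besov s f : C0v gamma delta f ->
  besov_norm gamma delta s (f \- V f)%R <=
  (1 + power_sum s M)%:E * ((1 + C)%:E * E q f) + besov_tail s M f.
Proof.
move=> fC; apply: besov_norm_cut => // [|k Mk]; first exact: operator_error.
have [Q sQ ->] := V_poly f; apply: best_approx_sub_horner.
exact: leq_trans sQ (leq_trans Mk _).
Qed.

(** The errors of [V f] vanish from degree [M] on; below [M], [E k (V f)] exceeds [E k f] by at most
    the norm of [V f - f]. This avoids a triangle inequality for the Besov norm. *)
Lemma operator_besov s f : C0v gamma delta f ->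
  besov_norm gamma delta s (V f) <=
  (1 + power_sum s M)%:E * ((1 + C)%:E * E q f)
  + (1 + C)%:E * besov_norm gamma delta s f.
Proof.
move=> fC; set A := (1 + C)%:E * E q f.
have C1 : (0 <= 1 + C)%R by rewrite addr_ge0 // ltW.
have A0 : 0 <= A by rewrite mule_ge0 ?best_approx_ge0.
have NA : N (V f \- f)%R <= A by rewrite wnorm_subC; apply: operator_error.
have tail0 : besov_tail s M (V f) = 0.
  apply: eseries0 => k Mk _; have [Q sQ ->] := V_poly f.
  by rewrite best_approx_horner ?mule0 // (leq_trans sQ) // (leq_trans Mk).
rewrite /besov_norm -[besov_sum _ _ _ (V f)]/(besov_tail s 1 (V f)).
rewrite (besov_sum_split _ _ M0) tail0 adde0.
rewrite ge0_muleDr ?wnorm_ge0 ?(besov_tail_ge0 s 1) //.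
rewrite addeCA; apply: leeD.
  apply: le_trans (V_bounded fC) _; rewrite lee_wpmul2r ?wnorm_ge0 // lee_fin; lra.
apply: (@le_trans _ _ (\sum_(1 <= k < M) (k.+1%:R `^ (s - 1))%:E * (A + E k f))).
  apply: lee_sum => k _; rewrite lee_wpmul2l ?lee_fin ?powR_ge0 //.
  apply: le_trans (best_approx_perturb _ _ f) _.
  by rewrite addeC leeD.
under eq_bigr do rewrite ge0_muleDr ?best_approx_ge0 //.
rewrite big_split /= sum_powR_const -/(power_sum s M); apply: leeD.
  by rewrite lee_wpmul2r // lee_fin; lra.
apply: (@le_trans _ _ (besov_sum gamma delta s f)).
  rewrite -[besov_sum _ _ _ f]/(besov_tail s 1 f) (besov_sum_split _ _ M0).
  by rewrite leeDl ?besov_tail_ge0.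
by rewrite -[leLHS]mul1e lee_wpmul2r ?(besov_tail_ge0 s 1) // lee_fin lerDl ltW.
Qed.

End Operator.

End Weighted.

(** * De la Vallee Poussin operators *)

(** From [m <= n / c1], the reproduced degree [n - m] is at least the positive fraction [1 - 1 / c1]
    of [n]. *)
Lemma comparable_pair_bounds (R : realType) (c1 c2 : R) n m :
  1 < c1 -> comparable_pair c1 c2 n m ->
  [/\ (0 < m)%N, (m < n)%N & (1 - c1^-1) * n%:R <= (n - m).+1%:R].
Proof.
move=> c1_gt1 [m0 mn _]; have c10 : 0 < c1 by apply: lt_trans c1_gt1.
have m0' : 0 < m%:R :> R by rewrite ltr0n.
have mltn : (m < n)%N.
  by rewrite -(ltr_nat R) (lt_le_trans _ mn) // ltr_pMl.
split => //; rewrite -natr1 natrB 1?ltnW // mulrBl mul1r.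
apply: (@le_trans _ _ (n%:R - m%:R)); last by rewrite lerDl.
by rewrite lerD2l lerN2 ler_pdivlMl.
Qed.

Lemma comparable_inftyP (R : realType) (c1 c2 : R) (P : nat * nat -> Prop) L :
  (forall n m, comparable_pair c1 c2 n m -> (L <= n)%N -> P (n, m)) ->
  \forall nm \near comparable_infty c1 c2, P nm.
Proof.
move=> h; rewrite /comparable_infty near_withinE.
exists ([set n | (L <= n)%N], setT).
  by split; [exact: nbhs_infty_ge|exact: filterT].
by move=> [n m] /= [Ln _]; move/h; apply.
Qed.

(** * Boundedness, convergence and rates in Besov norms *)

Section VPApproximation.
Variables (R : realType) (alpha beta gamma delta c1 c2 C : R) (p : nat -> {poly R}).
Hypotheses (hgamma : 0 <= gamma) (hdelta : 0 <= delta) (hc1 : 1 < c1).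
Hypothesis hp : orthonormal_jacobi alpha beta p.
Hypothesis C0 : 0 < C.
Hypothesis hV : forall (n m : nat) (f : R -> R),
  comparable_pair c1 c2 n m -> C0v gamma delta f ->
  (wnorm gamma delta (vp_op p n m f) <= C%:E * wnorm gamma delta f)%E.

Let c := 1 - c1^-1.
Let c0 : 0 < c.
Proof. by rewrite subr_gt0 invf_lt1 // (lt_trans ltr01). Qed.

Lemma vp_error_besov s n m f : comparable_pair c1 c2 n m -> C0v gamma delta f ->
  (besov_norm gamma delta s (f \- vp_op p n m f)%R <=
   (1 + power_sum s (n + m))%:E * ((1 + C)%:E * best_approx gamma delta (n - m) f)
   + besov_tail gamma delta s (n + m) f)%E.
Proof.
move=> cp fC; have [m0 mn _] := comparable_pair_bounds hc1 cp.
apply: operator_error_besov => // [|g|g h|P sP|g gC].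
- by rewrite addn_gt0 m0 orbT.
- exact: (vp_op_poly hp).
- exact: (vp_opB hp).
- exact: (vp_op_id hp).
- exact: hV.
Qed.

Lemma vp_besov s n m f : comparable_pair c1 c2 n m -> C0v gamma delta f ->
  (besov_norm gamma delta s (vp_op p n m f) <=
   (1 + power_sum s (n + m))%:E * ((1 + C)%:E * best_approx gamma delta (n - m) f)
   + (1 + C)%:E * besov_norm gamma delta s f)%E.
Proof.
move=> cp fC; have [m0 mn _] := comparable_pair_bounds hc1 cp.
apply: operator_besov => // [|g|g h|P sP|g gC].
- by rewrite addn_gt0 m0 orbT.
- exact: (vp_op_poly hp).
- exact: (vp_opB hp).
- exact: (vp_op_id hp).
- exact: hV.
Qed.

(** Moves the power sum from [n + m], the degree range of the image, down to [n - m + 1], where its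
    product with the error of degree [n - m] is controlled by [f] alone. *)
Lemma vp_doubling s : 0 <= s -> exists2 K : R, 0 < K &
  forall n m f, comparable_pair c1 c2 n m ->
  ((1 + power_sum s (n + m))%:E * ((1 + C)%:E * best_approx gamma delta (n - m) f) <=
   K%:E * ((1 + power_sum s (n - m).+1)%:E * best_approx gamma delta (n - m) f))%E.
Proof.
move=> s0; have [K K0 hK] := power_sum_doubling s0 c0.
exists (K * (1 + C)) => [|n m f cp]; first by rewrite mulr_gt0 ?addr_gt0.
have [m0 mn cn] := comparable_pair_bounds hc1 cp.
rewrite !muleA -!EFinM lee_wpmul2r ?best_approx_ge0 // lee_fin [leRHS]mulrAC.
rewrite ler_wpM2r ?addr_ge0 ?(ltW C0) // (hK n) //.
  by rewrite addn_gt0 m0 orbT.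
by rewrite -natrM ler_nat mul2n -addnn leq_add2l ltnW.
Qed.

Lemma vp_bounded r : 0 <= r -> exists2 K : R, 0 < K &
  forall (n m : nat) (f : R -> R),
    comparable_pair c1 c2 n m -> besov gamma delta r f ->
    besov gamma delta r (vp_op p n m f) /\
    (besov_norm gamma delta r (vp_op p n m f) <= K%:E * besov_norm gamma delta r f)%E.
Proof.
move=> r0; have [K K0 hK] := vp_doubling r0.
exists (K + (1 + C)) => [|n m f cp [fC fB]]; first by rewrite !addr_gt0.
have bound : (besov_norm gamma delta r (vp_op p n m f) <=
    (K + (1 + C))%:E * besov_norm gamma delta r f)%E.
  apply: le_trans (vp_besov r cp fC) _.
  rewrite (EFinD K) ge0_muleDl ?lee_fin ?addr_ge0 ?(ltW C0) ?(ltW K0) //.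
  apply: leeD => //; apply: le_trans (hK n m f cp) _.
  by rewrite lee_wpmul2l ?lee_fin ?(ltW K0) // best_approx_besov_norm.
split=> //; split.
  by have [Q _ ->] := vp_op_poly hp n m f; apply: C0v_horner.
apply: (@le_lt_trans _ _ (besov_norm gamma delta r (vp_op p n m f))).
  by rewrite leeDr ?wnorm_ge0.
apply: le_lt_trans bound _.
by rewrite -(fineK (besov_norm_fin hgamma hdelta fB)) -EFinM ltry.
Qed.

Lemma vp_cvg r f : 0 <= r -> besov gamma delta r f ->
  besov_norm gamma delta r (f \- vp_op p nm.1 nm.2 f)%R
    @[nm --> comparable_infty c1 c2] --> 0%E.
Proof.
move=> r0 [fC fB]; have [K K0 hK] := vp_doubling r0.
have key e : 0 < e -> \forall nm \near comparable_infty c1 c2,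
    (besov_norm gamma delta r (f \- vp_op p nm.1 nm.2 f)%R <= e%:E)%E.
  move=> e0; have e20 : 0 < e / 2 by rewrite divr_gt0.
  have [L1 L10 h1] := besov_tail_small hgamma hdelta e20 fB.
  have eK0 : 0 < e / 2 / K by rewrite divr_gt0.
  have [L2 h2] := best_approx_power_sum_small hgamma hdelta r0 eK0 fB.
  (* As [c n <= n - m + 1], taking [n >= (L2 + 1) / c] ensures [n - m >= L2]. *)
  apply: (@comparable_inftyP _ _ _ _ (maxn L1 (Num.bound (L2.+1%:R / c)))) => n m cp.
  rewrite geq_max => /andP[nL1 nL2].
  have [m0 mn cn] := comparable_pair_bounds hc1 cp.
  have L2q : (L2 <= n - m)%N.
    rewrite -ltnS -(ler_nat R); apply: le_trans cn.
    rewrite -ler_pdivrMl // mulrC; apply: le_trans (ltW (archi_boundP _)) _.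
      by rewrite divr_ge0 ?(ltW c0).
    by rewrite ler_nat.
  apply: le_trans (vp_error_besov r cp fC) _.
  have -> : e%:E = ((e / 2)%:E + (e / 2)%:E)%E by rewrite -EFinD -splitr.
  apply: leeD; last by apply: h1; rewrite (leq_trans nL1) ?leq_addr.
  apply: le_trans (hK n m f cp) _.
  rewrite -lee_pdivlMl // -EFinM mulrC; exact: h2.
have FF : Filter (comparable_infty c1 c2).
  by rewrite /comparable_infty; exact: within_filter.
(* Convergence of extended reals to a finite limit means being eventually finite, here by the bound
   with [e = 1], and convergence of the real parts. *)
apply/fine_cvgP; split.
  apply: filterS (key 1 ltr01) => nm h; rewrite ge0_fin_numE ?besov_norm_ge0 //.
  exact: le_lt_trans h (ltry _).
apply/cvgrPdist_le => e e0; apply: filterS (key e e0) => nm h /=.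
rewrite sub0r normrN ger0_norm ?fine_ge0 ?besov_norm_ge0 // -lee_fin fineK //.
rewrite ge0_fin_numE ?besov_norm_ge0 //; exact: le_lt_trans h (ltry _).
Qed.

(** Common source of both rates: the first summand is the degree [n - m] error weighted by the power
    sum, the second is the tail. The two rates differ only in the growth of
    [power_sum s (n + m)]. *)
Lemma vp_rate r s : 0 < r -> s <= r -> exists2 K : R, 0 < K &
  forall (n m : nat) (f : R -> R),
    comparable_pair c1 c2 n m -> besov gamma delta r f ->
    (besov_norm gamma delta s (f \- vp_op p n m f)%R <=
     (K * (1 + power_sum s (n + m)) / n%:R `^ r + (n%:R `^ (r - s))^-1)%:E
     * besov_norm gamma delta r f)%E.
Proof.
move=> r0 sr; pose K := (1 + C) * ((1 + 2 * r) / c `^ r).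
have K0 : 0 < K.
  by rewrite mulr_gt0 ?addr_gt0 // divr_gt0 ?powR_gt0 // addr_gt0 ?mulr_gt0.
exists K => // n m f cp [fC fB].
have [m0 mn cn] := comparable_pair_bounds hc1 cp.
have n0 : (0 < n)%N by apply: leq_ltn_trans mn.
have S0 := power_sum_ge0 s (n + m).
apply: le_trans (vp_error_besov s cp fC) _.
rewrite [in leRHS]EFinD [leRHS]ge0_muleDl ?lee_fin ?invr_ge0 ?powR_ge0 //; last first.
  by rewrite divr_ge0 ?powR_ge0 // mulr_ge0 ?(ltW K0) // addr_ge0.
apply: leeD.
  have hE := best_approx_rate gamma delta f r0 c0 n0 cn.
  rewrite muleA -EFinM.
  apply: le_trans (lee_wpmul2l _ hE) _.
    by rewrite lee_fin mulr_ge0 ?addr_ge0 ?(ltW C0).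
  rewrite muleA -EFinM lee_wpmul2r ?besov_norm_ge0 // lee_fin le_eqVlt.
  by apply/orP; left; apply/eqP; rewrite /K; ring.
apply: le_trans (besov_tail_rate gamma delta f sr n0 (leq_addr m n)) _.
rewrite lee_wpmul2l ?lee_fin ?invr_ge0 ?powR_ge0 //.
apply: le_trans (besov_tail_le _ _ _ _ _) _ => //; first by rewrite addn_gt0 n0.
by rewrite leeDr ?wnorm_ge0.
Qed.

Lemma vp_rate_log r : 0 < r -> exists2 K : R, 0 < K &
  forall (n m : nat) (f : R -> R),
    comparable_pair c1 c2 n m -> besov gamma delta r f ->
    (besov_norm gamma delta 0 (f \- vp_op p n m f)%R
       <= (K * (ln n%:R / n%:R `^ r))%:E * besov_norm gamma delta r f)%E.
Proof.
move=> r0; have [K K0 hK] := vp_rate r0 (ltW r0).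
have l2 : 0 < ln 2 :> R by rewrite ln_gt0 // ltr1n.
have l2V : 0 < (ln 2)^-1 :> R by rewrite invr_gt0.
(* The 2 comes from [S_0(n + m) <= ln (2 n) <= 2 ln n]. Since [n > m > 0] gives [n >= 2], one has
   [1 <= ln n / ln 2], which absorbs both the summand 1 and the tail. *)
exists (K * (2 + (ln 2)^-1) + (ln 2)^-1) => [|n m f cp fB].
  by rewrite addr_gt0 // mulr_gt0 // addr_gt0.
have [m0 mn cn] := comparable_pair_bounds hc1 cp.
apply: le_trans (hK n m f cp fB) _.
rewrite lee_wpmul2r ?besov_norm_ge0 // lee_fin subr0 -mulrA.
have nr : 0 <= (n%:R `^ r)^-1 :> R by rewrite invr_ge0 powR_ge0.
have n2 : (2 <= n)%N by apply: leq_ltn_trans mn.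
have lnn : ln 2 <= ln n%:R :> R.
  by rewrite ler_ln ?posrE ?ltr0n ?ler_nat // (leq_trans _ n2).
have h1 : 1 <= (ln 2)^-1 * ln n%:R :> R by rewrite ler_pdivlMl // mulr1.
have h2 : power_sum 0 (n + m) <= 2 * ln n%:R :> R.
  apply: le_trans (power_sum0_le _ _) _; first by rewrite addn_gt0 m0 orbT.
  rewrite (@le_trans _ _ (ln (2 * n%:R))) //.
    rewrite ler_ln ?posrE -?natrM ?ltr0n ?ler_nat ?muln_gt0 ?addn_gt0 ?m0 ?orbT //.
      by rewrite mul2n -addnn leq_add2l ltnW.
    by rewrite (leq_trans _ n2).
  rewrite lnM ?posrE ?ltr0n //; last by rewrite (leq_trans _ n2).
  lra.
have -> : (K * (2 + (ln 2)^-1) + (ln 2)^-1) * (ln n%:R / n%:R `^ r) =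
    K * ((2 * ln n%:R + (ln 2)^-1 * ln n%:R) / n%:R `^ r)
    + (ln 2)^-1 * ln n%:R * (n%:R `^ r)^-1 by ring.
apply: lerD; last by rewrite -[leLHS]mul1r ler_wpM2r.
by rewrite ler_wpM2l ?(ltW K0) // ler_wpM2r // addrC lerD.
Qed.

Lemma vp_rate_pow r s : 0 < s -> s <= r -> exists2 K : R, 0 < K &
  forall (n m : nat) (f : R -> R),
    comparable_pair c1 c2 n m -> besov gamma delta r f ->
    (besov_norm gamma delta s (f \- vp_op p n m f)%R
       <= (K / n%:R `^ (r - s))%:E * besov_norm gamma delta r f)%E.
Proof.
move=> s0 sr; have r0 := lt_le_trans s0 sr; have [K K0 hK] := vp_rate r0 sr.
(* With [n + m <= 2 n], [S_s(n + m) <= a n^s], and [1 <= n^s] absorbs the summand 1. The final [+ 1]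
   in the constant is the tail. *)
pose a : R := 2 `^ s / s * 2 `^ s.
have a0 : 0 < a by rewrite !mulr_gt0 ?invr_gt0 ?powR_gt0.
exists (K * (1 + a) + 1) => [|n m f cp fB].
  by rewrite addr_gt0 // mulr_gt0 // addr_gt0.
have [m0 mn cn] := comparable_pair_bounds hc1 cp.
have n0 : (0 < n)%N by apply: leq_ltn_trans mn.
apply: le_trans (hK n m f cp fB) _.
rewrite lee_wpmul2r ?besov_norm_ge0 // lee_fin.
have ns0 : 0 < n%:R `^ s :> R by rewrite powR_gt0 // ltr0n.
have h1 : 1 <= n%:R `^ s :> R.
  by rewrite -[leLHS](powRr0 n%:R) ler_powR ?ler1n // ltW.
have h2 : power_sum s (n + m) <= a * n%:R `^ s.
  apply: le_trans (power_sum_le s0 _) _; first by rewrite addn_gt0 n0.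
  rewrite /a -[leRHS]mulrA -powRM // ler_wpM2l ?divr_ge0 ?powR_ge0 ?(ltW s0) //.
  rewrite ge0_ler_powR ?nnegrE ?(ltW s0) ?mulr_ge0 //.
  by rewrite -natrM ler_nat mul2n -addnn leq_add2l ltnW.
have -> : (K * (1 + a) + 1) / n%:R `^ (r - s) =
    K * ((1 + a) * n%:R `^ s) / n%:R `^ r + (n%:R `^ (r - s))^-1.
  rewrite powRB ?pnatr_eq0 -?lt0n ?n0 ?implybT //; field.
  by rewrite !gt_eqF // powR_gt0 // ltr0n.
rewrite lerD2r ler_wpM2r ?invr_ge0 ?powR_ge0 // ler_wpM2l ?(ltW K0) //.
by rewrite mulrDl mul1r lerD.
Qed.

End VPApproximation.

Theorem theorem3p2 (R : realType) (alpha beta gamma delta c1 c2 : R)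
    (p : nat -> {poly R})
    (halpha : -1 < alpha) (hbeta : -1 < beta)
    (hgamma : 0 <= gamma) (hdelta : 0 <= delta)
    (hc1 : 1 < c1) (hc12 : c1 <= c2)
    (hp : orthonormal_jacobi alpha beta p)
    (hV : exists2 C : R, 0 < C &
       forall (n m : nat) (f : R -> R),
         comparable_pair c1 c2 n m -> C0v gamma delta f ->
         (wnorm gamma delta (vp_op p n m f) <= C%:E * wnorm gamma delta f)%E) :
  (* (i) *)
  (forall r : R, 0 <= r ->
     (exists2 C : R, 0 < C &
        forall (n m : nat) (f : R -> R),
          comparable_pair c1 c2 n m -> besov gamma delta r f ->
          besov gamma delta r (vp_op p n m f) /\
          (besov_norm gamma delta r (vp_op p n m f)
             <= C%:E * besov_norm gamma delta r f)%E) /\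
     (forall f : R -> R, besov gamma delta r f ->
        besov_norm gamma delta r (f \- vp_op p nm.1 nm.2 f)%R
          @[nm --> comparable_infty c1 c2] --> 0%E)) /\
  (* (ii) *)
  (forall r : R, 0 < r ->
     exists2 C : R, 0 < C &
       forall (n m : nat) (f : R -> R),
         comparable_pair c1 c2 n m -> besov gamma delta r f ->
         (besov_norm gamma delta 0 (f \- vp_op p n m f)%R
            <= (C * (ln n%:R / n%:R `^ r))%:E * besov_norm gamma delta r f)%E) /\
  (forall r s : R, 0 < s -> s <= r ->
     exists2 C : R, 0 < C &
       forall (n m : nat) (f : R -> R),
         comparable_pair c1 c2 n m -> besov gamma delta r f ->
         (besov_norm gamma delta s (f \- vp_op p n m f)%R
            <= (C / n%:R `^ (r - s))%:E * besov_norm gamma delta r f)%E).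
Proof.
have [C C0 bounded] := hV.
split=> [r r0|]; first split.
- exact: (vp_bounded hgamma hdelta hc1 hp C0 bounded r0).
- by move=> f; exact: (vp_cvg hgamma hdelta hc1 hp C0 bounded r0).
- split=> [r r0|r s s0 sr].
    exact: (vp_rate_log hc1 hp C0 bounded r0).
  exact: (vp_rate_pow hc1 hp C0 bounded s0 sr).
Qed.
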